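(* Let $d\ge 1$ be an integer. There exists a set $\mathfrak{F}\subset\mathbb{R}^{d+1}$ of finite density together with a function $\mathcal{V}:(0,\epsilon_0)\to[0,\infty)$ (for some $\epsilon_0>0$) such that: (i) for every $\epsilon\in(0,\epsilon_0)$, every $\bm{x}\in\mathbb{R}^{d+1}$ and every $\bm{v}\in\mathbb{S}^d_2$, there exist $t\in[0,\mathcal{V}(\epsilon)]$ and $\bm{f}\in\mathfrak{F}$ with $\|\bm{x}+t\bm{v}-\bm{f}\|_2\le\epsilon$ (i.e. $\mathfrak{F}$ is a dense forest with visibility function $\mathcal{V}$); (ii) for every $\eta>0$ there is a constant $C_{\eta,d}>0$, depending only on $\eta$ and $d$, such that $\mathcal{V}(\epsilon)\le C_{\eta,d}\,\epsilon^{-2d-\eta}$ for all sufficiently small $\epsilon>0$.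
   Context: $\|\cdot\|_2$ is the Euclidean norm on $\mathbb{R}^{d+1}$ and $\mathbb{S}^d_2$ the Euclidean unit sphere in $\mathbb{R}^{d+1}$. A set $\mathfrak{F}\subset\mathbb{R}^{d+1}$ has finite density if $\limsup_{T\to+\infty}\#(\mathfrak{F}\cap B_2(\bm{0},T))/T^{d+1}<+\infty$, where $B_2(\bm{0},T)$ is the Euclidean ball of radius $T$ centred at the origin. *)

(* Defs.v *)
From HB Require Import structures.
From mathcomp Require Import all_boot all_order all_algebra.
From mathcomp Require Import all_classical all_reals all_analysis.

Set Implicit Arguments.
Unset Strict Implicit.
Unset Printing Implicit Defensive.

Import Order.TTheory GRing.Theory Num.Theory.
Import numFieldNormedType.Exports.

Local Open Scope classical_set_scope.
Local Open Scope ring_scope.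

(* The library norm `|x| on 'rV[R]_n is the sup norm, hence a separate
   Euclidean norm. *)
Definition norm2 (R : realType) (n : nat) (x : 'rV[R]_n) : R :=
  Num.sqrt (\sum_(i < n) x 0 i ^+ 2).

Definition ball2 (R : realType) (n : nat) (c : 'rV[R]_n) (T : R) :
    set 'rV[R]_n := [set x | norm2 (x - c) <= T].

Definition sphere2 (R : realType) (n : nat) : set 'rV[R]_n :=
  [set v | norm2 v = 1].

(* [counting] takes the value +oo on infinite sets, so finite density implies
   that F meets every ball in a finite set. *)
Definition finite_density (R : realType) (n : nat) (F : set 'rV[R]_n) : Prop :=
  (limf_esup
     (fun T : R => counting (F `&` ball2 0 T) * ((T ^+ n)^-1)%:E)
     (pinfty_nbhs R) < +oo)%E.

(* V stands for a function (0, eps0) -> [0, +oo); its values outside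
   (0, eps0) are irrelevant. *)
Definition dense_forest (R : realType) (n : nat) (F : set 'rV[R]_n)
    (eps0 : R) (V : R -> R) : Prop :=
  forall (eps : R) (x v : 'rV[R]_n),
    0 < eps < eps0 -> sphere2 v ->
    exists (t : R) (f : 'rV[R]_n),
      [/\ 0 <= t <= V eps, F f & norm2 (x + t *: v - f) <= eps].

(* Main.v *)
(**
At scale [h = 2^-k], put points of the grid [h Z^D], [D = d + 1], periodically
with [N] grid steps per period, [N = 2^(k(2d+1))].  After rounding, a segment
that advances by [N] steps in its steepest coordinate meets [N] distinct cells
of the torus [(Z/N)^D], and there are only polynomially many (in [N]) rounded
segments.  A greedy choice therefore yields [O(N^d log N)] cells meeting all of
them; since the period has length [A_k = h N = 2^(2dk)], the resulting periodic
set has density [O(k 2^(-kd))], which is summable in [k].  Deleting its points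
in the ball of radius [A_k] makes the union over [k] of finite density, at the
cost of first letting each ray travel a distance [O(A_k)] out of that ball.
Hence the visibility is [O(eps^(-2d))].
*)
Require Import Defs.
From HB Require Import structures.
From mathcomp Require Import all_boot all_order all_algebra.
From mathcomp Require Import zify ring lra.

Set Implicit Arguments.
Unset Strict Implicit.
Unset Printing Implicit Defensive.

(** * Greedy hitting sets, and digital lines on a finite torus *)

(** Bernoulli's inequality for [(1 + 1/(M-1)) ^ M]. It makes [M] rounds of the greedy choice below
    halve the number of sets still missed. *)
Lemma double_pred_expnn M : (0 < M)%N -> (2 * M.-1 ^ M <= M ^ M)%N.
Proof.
case: M => [|M] //= _.
have bern n : (M ^ n * (M + n) <= M * M.+1 ^ n)%N.
  elim: n => [|n IHn]; first by rewrite !expn0 mul1n muln1 addn0.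
  rewrite ![(_ ^ n.+1)%N]expnS.
  have := leq_mul (leqnn M.+1) IHn.
  rewrite !(mulnA, mulnCA M.+1); nia.
case: (posnP M) => [-> | M_gt0]; first by [].
have := bern M.+1; rewrite expnS; nia.
Qed.

(** By averaging, some point lies in at least a fraction [1/M] of the sets still missed; adding it
    to [P] multiplies their number by at most [1 - 1/M]. After [M * J] choices fewer than
    [#|I| / 2 ^ J + 1] sets could remain, and strictness of [#|I| < 2 ^ J] leaves none. *)
Lemma hitting_set (T I : finType) (S : I -> {set T}) (M J : nat) :
  (0 < #|T|)%N -> (forall i, #|T| <= M * #|S i|)%N -> (#|I| < 2 ^ J)%N ->
  exists2 P : {set T}, (#|P| <= M * J)%N &
    forall i, exists2 x, x \in P & x \in S i.
Proof.
move=> T_gt0 leTS ltI.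
pose U (P : {set T}) := [set i | [disjoint P & S i]].
have greedy m : exists2 P : {set T}, (#|P| <= m)%N &
    (#|U P| * M ^ m <= #|I| * M.-1 ^ m)%N.
  elim: m => [|m [P leP leU]].
    by exists set0; rewrite ?cards0 // !expn0 !muln1 max_card.
  (* Double counting of the incidences between points and missed sets. *)
  have count : (\sum_(x : T) #|[set i in U P | x \in S i]| =
                \sum_(i in U P) #|S i|)%N.
    under eq_bigr => x _ do rewrite -sum1dep_card.
    under [RHS]eq_bigr => i _ do rewrite -sum1_card.
    rewrite (exchange_big_dep (mem (U P))) /=; last by move=> x i _ /andP[].
    by apply: eq_bigr => i iU; apply: eq_bigl => x; rewrite iU.
  have [x xU] : exists x, (#|U P| <= M * #|[set i in U P | x \in S i]|)%N.
    apply/existsP; apply: contraT; rewrite negb_exists => /forallP ltU.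
    have : (\sum_(x : T) M * #|[set i in U P | x \in S i]| <
            \sum_(x : T) #|U P|)%N.
      case/card_gt0P: T_gt0 => x0 _.
      rewrite (bigD1 x0) //= [X in (_ < X)%N](bigD1 x0) //=.
      rewrite -addSn leq_add ?ltnNge ?ltU // leq_sum // => x _.
      by rewrite ltnW // ltnNge ltU.
    rewrite -big_distrr count sum_nat_const /= big_distrr /= ltnNge.
    case/negP; rewrite mulnC -sum_nat_const.
    exact: leq_sum.
  exists (x |: P); first by rewrite cardsU1; case: (_ \notin _); lia.
  have splitU : (#|U P| =
      #|[set i in U P | x \in S i]| + #|U (x |: P)|)%N.
    rewrite -(cardsID [set i | x \in S i]); congr (_ + _)%N.
      by apply: eq_card => i; rewrite !inE.
    apply: eq_card => i; rewrite !inE -!setI_eq0 setIUl setU_eq0.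
    by rewrite (setI_eq0 [set x]) disjoints1.
  have step : (#|U (x |: P)| * M <= #|U P| * M.-1)%N by nia.
  rewrite !expnS; move: step leU.
  move: (#|U P|) (#|U _|) (M ^ m)%N (M.-1 ^ m)%N => a b p q step leU.
  have := leq_mul (leqnn M.-1) leU; have := leq_mul step (leqnn p); lia.
have [P leP leU] := greedy (M * J)%N.
exists P => // i.
have iNU : i \notin U P.
  apply/negP => iU.
  have U_gt0 : (0 < #|U P|)%N by apply/card_gt0P; exists i.
  have M_gt0 : (0 < M)%N by case: posnP (leTS i) => // ->; lia.
  have le2 : (2 ^ J * M.-1 ^ (M * J) <= M ^ (M * J))%N.
    rewrite !expnM -expnMn; case: (J) => [|J'] //.
    by rewrite leq_exp2r // double_pred_expnn.
  have Mp_gt0 : (0 < M ^ (M * J))%N by rewrite expn_gt0 M_gt0.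
  move: leU le2 Mp_gt0; move: (M ^ _)%N (M.-1 ^ _)%N => p q leU le2 p_gt0.
  have := leq_mul ltI (leqnn q); have := leq_mul U_gt0 (leqnn p); nia.
move: iNU; rewrite inE => /pred0Pn[x /andP[xP xS]]; by exists x.
Qed.

(* A line of slope [W l / N - 1] in the [l]-th coordinate, rounded to the grid
   and reduced modulo [N = n + 1]; the summand [n * j] stands for [- j]. *)
Definition digital_line (n D : nat) (a : {ffun 'I_D -> 'I_n.+1})
    (W : {ffun 'I_D -> 'I_(2 * n.+1).+1}) (j : 'I_n.+1) :
    {ffun 'I_D -> 'I_n.+1} :=
  [ffun l => inZp (a l + j * W l %/ n.+1 + n * j)].

(** The slopes -1 and 1: some coordinate moves by exactly one cell per step. *)
Definition steep (n D : nat) (W : {ffun 'I_D -> 'I_(2 * n.+1).+1}) :=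
  [exists i, (W i == 0 :> nat) || (W i == 2 * n.+1 :> nat)].

(** In a steep coordinate the position is [a i - j] or [a i + j] modulo [N], and [j] runs over one
    full period. *)
Lemma digital_line_inj n D (a : {ffun 'I_D -> 'I_n.+1}) W :
  steep W -> injective (digital_line a W).
Proof.
case/existsP=> i Wi j j' /ffunP/(_ i); rewrite !ffunE => /(congr1 val) /=.
rewrite -!addnA => /eqP; rewrite eqn_modDl => /eqP eqj; apply: val_inj => /=.
case/orP: Wi eqj => /eqP ->.
  rewrite !muln0 div0n !add0n => eqj.
  (* Adding [j + j'] to both sides completes each [n * j] to a multiple of [N]. *)
  have : (n * j + (j + j') = n * j' + (j + j') %[mod n.+1])%N.
    by apply/eqP; rewrite eqn_modDr; apply/eqP.
  have -> : (n * j + (j + j') = j * n.+1 + j')%N by lia.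
  have -> : (n * j' + (j + j') = j' * n.+1 + j)%N by lia.
  by rewrite !modnMDl !modn_small.
rewrite !mulnA !mulnK // => eqj.
have dec (k : nat) : (k * 2 + n * k = k * n.+1 + k)%N by lia.
by move: eqj; rewrite !dec !modnMDl !modn_small.
Qed.

Lemma digital_hitting_set (n d J : nat) :
  ((n.+1 * (2 * n.+1).+1) ^ d.+1 < 2 ^ J)%N ->
  exists2 P : {set {ffun 'I_d.+1 -> 'I_n.+1}}, (#|P| <= n.+1 ^ d * J)%N &
    forall a W, steep W -> exists j, digital_line a W j \in P.
Proof.
move=> ltJ.
pose I := ({ffun 'I_d.+1 -> 'I_n.+1} *
           {ffun 'I_d.+1 -> 'I_(2 * n.+1).+1})%type.
(* Pairs that are not steep get the whole torus, so that every set has at least [N] of the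
   [N ^ d.+1] cells. *)
pose S (i : I) := if steep i.2 then [set digital_line i.1 i.2 j | j in 'I_n.+1]
                  else [set: {ffun 'I_d.+1 -> 'I_n.+1}].
have [||| P leP hitP] := @hitting_set _ I S (n.+1 ^ d) J.
- by rewrite card_ffun !card_ord expn_gt0.
- move=> [a W]; rewrite /S /=; case: ifPn => [sW | _].
    rewrite card_imset; last exact: digital_line_inj.
    by rewrite card_ffun !card_ord expnSr.
  by rewrite cardsT leq_pmull // expn_gt0.
- by rewrite card_prod !card_ffun !card_ord -expnMn.
exists P => // a W sW; have [x xP] := hitP (a, W).
by rewrite /S /= sW => /imsetP[j _ defx]; exists j; rewrite -defx.
Qed.

(* Imported only here because it shadows the names of finite set theory. *)
From mathcomp Require Import finmap.
From mathcomp Require Import all_classical all_reals all_analysis.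

Import Order.TTheory GRing.Theory Num.Theory.
Import numFieldNormedType.Exports.

Local Open Scope classical_set_scope.
Local Open Scope ring_scope.

(** * Comparison of norms, and rounding of real lines to digital ones *)

Lemma le_coord_norm2 (R : realType) (n : nat) (x : 'rV[R]_n) (i : 'I_n) :
  `|x 0 i| <= norm2 x.
Proof.
rewrite -sqrtr_sqr ler_wsqrtr // (bigD1 i) //= lerDl sumr_ge0 // => j _.
exact: sqr_ge0.
Qed.

Lemma norm2_le_coord (R : realType) (n : nat) (x : 'rV[R]_n) (e : R) :
  0 <= e -> (forall i, `|x 0 i| <= e) -> norm2 x <= n%:R * e.
Proof.
move=> e_ge0 xe; rewrite -[leRHS]ger0_norm ?mulr_ge0 // -sqrtr_sqr.
rewrite ler_wsqrtr //.
apply: (@le_trans _ _ (\sum_(i < n) e ^+ 2)).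
  by apply: ler_sum => i _; rewrite -real_normK ?num_real // ler_sqr ?nnegrE.
rewrite sumr_const card_ord -[leLHS]mulr_natl exprMn ler_wpM2r ?sqr_ge0 //.
by rewrite -natrX ler_nat; case: (n) => // m; rewrite expnS leq_pmulr // expn1.
Qed.

Lemma sphere2_max_coord (R : realType) (d : nat) (v : 'rV[R]_d.+1) :
  sphere2 v -> exists2 i, 1 <= d.+1%:R * `|v 0 i| &
    forall l, `|v 0 l| <= `|v 0 i|.
Proof.
move=> v1.
case: (@arg_maxP _ R 'I_d.+1 ord0 xpredT (fun i => `|v 0 i|) isT) => i _ maxi.
have max l : `|v 0 l| <= `|v 0 i| by exact: maxi.
by exists i => //; rewrite -[leLHS]v1; apply: norm2_le_coord.
Qed.

(** Three roundings down, of [u], of the slope (whose error is multiplied by [j / N < 1]) and of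
    [j * w / N], each contribute an error between 0 and 1. The slopes -1 and 1 are rounded exactly,
    which preserves steepness. *)
Lemma digital_approx1 (R : realType) (n : nat) (u s : R) :
  -1 <= s <= 1 ->
  exists (a : 'I_n.+1) (w : 'I_(2 * n.+1).+1),
    (`|s| = 1 -> (w == 0 :> nat) || (w == 2 * n.+1 :> nat)%N) /\
    forall j : 'I_n.+1, exists y : int,
      0 <= u + j%:R * s - ((inZp (a + j * w %/ n.+1 + n * j) : 'I_n.+1)%:R
                           + n.+1%:R * y%:~R) <= 3.
Proof.
move=> /andP[s_ge s_le].
have N0 : 0 < n.+1%:R :> R by rewrite ltr0n.
have sN_ge0 : 0 <= (s + 1) * n.+1%:R by rewrite mulr_ge0 ?ler0n //; lra.
pose w := Num.truncn ((s + 1) * n.+1%:R).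
have /andP[w_le w_gt] : w%:R <= (s + 1) * n.+1%:R < w.+1%:R.
  exact: truncn_itv.
have w_lt : (w < (2 * n.+1).+1)%N.
  rewrite ltnS -(ler_nat R) (le_trans w_le) // natrM ler_wpM2r //; lra.
have a_lt : (`|(Num.floor u %% n.+1)%Z|%N < n.+1)%N by lia.
exists (Ordinal a_lt), (Ordinal w_lt); split=> [s1 | j] /=.
  have /eqP := s1; rewrite eqr_norml ler01 andbT => /orP[] /eqP sE.
    by apply/orP; right; apply/eqP; rewrite /w sE -(natrD R 1 1) -natrM natrK.
  by rewrite /w sE addNr mul0r truncn0.
set m := (_ + _ + _)%N.
(* The multiple of [N] collects both quotients; the final [- j] turns [n * j] back into [- j]. *)
exists ((Num.floor u %/ n.+1)%Z + (m %/ n.+1)%N%:Z - (j : nat)%:Z).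
have /andP[fl_le fl_gt] := floor_itv u.
set r := (j * w %/ n.+1)%N in m *.
have zE : ((m %% n.+1)%N%:Z + n.+1%:Z * ((Num.floor u %/ n.+1)%Z
    + (m %/ n.+1)%N%:Z - (j : nat)%:Z) = Num.floor u + r%:Z - (j : nat)%:Z).
  have := divn_eq m n.+1; have := divz_eq (Num.floor u) n.+1.
  rewrite {2}/m; nia.
have -> : (m %% n.+1)%:R + n.+1%:R * ((Num.floor u %/ n.+1)%Z
    + (m %/ n.+1)%N%:Z - (j : nat)%:Z)%:~R
    = (Num.floor u)%:~R + r%:R - j%:R :> R.
  have /(congr1 (fun z : int => z%:~R : R)) := zE.
  by rewrite !(rmorphD, rmorphN, rmorphM) /= -!pmulrn => ->.
have r_le : r%:R * n.+1%:R <= j%:R * w%:R :> R.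
  by rewrite -!natrM ler_nat leq_trunc_div.
have r_gt : j%:R * w%:R <= (r%:R + 1) * n.+1%:R :> R.
  by rewrite natr1 -!natrM ler_nat ltnW // ltn_ceil.
have jN : j%:R <= n.+1%:R :> R by rewrite ler_nat ltnW.
have j_ge0 : 0 <= j%:R :> R by [].
move: fl_gt w_gt; rewrite rmorphD /= -natr1 => fl_gt w_gt.
apply/andP; split; rewrite -(ler_pM2r N0); nra.
Qed.

Lemma digital_approx (R : realType) (n D : nat) (u s : 'I_D -> R) :
  (forall l, -1 <= s l <= 1) -> (exists i, `|s i| = 1) ->
  exists (a : {ffun 'I_D -> 'I_n.+1}) W, steep W /\
    forall j : 'I_n.+1, exists y : 'I_D -> int, forall l,
      0 <= u l + j%:R * s l - ((digital_line a W j l)%:R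
                               + n.+1%:R * (y l)%:~R) <= 3.
Proof.
move=> s1 [i si1].
have /choice[aw awP] : forall l, exists aw : 'I_n.+1 * 'I_(2 * n.+1).+1,
    (`|s l| = 1 -> (aw.2 == 0 :> nat) || (aw.2 == 2 * n.+1 :> nat)%N) /\
    forall j : 'I_n.+1, exists y : int,
      0 <= u l + j%:R * s l -
        ((inZp (aw.1 + j * aw.2 %/ n.+1 + n * j) : 'I_n.+1)%:R
         + n.+1%:R * y%:~R) <= 3.
  move=> l; have [a [w ?]] := digital_approx1 n (u l) (s1 l).
  by exists (a, w).
exists [ffun l => (aw l).1], [ffun l => (aw l).2]; split.
  by apply/existsP; exists i; rewrite ffunE; apply: (awP i).1.
move=> j; have /choice[y yP] := fun l => (awP l).2 j.
by exists y => l; rewrite !ffunE.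
Qed.

(** * Periodic sets: visibility and counting *)

Definition periodic_set (R : realType) (n D : nat) (h : R)
    (P : {set {ffun 'I_D -> 'I_n.+1}}) : set 'rV[R]_D :=
  [set f | exists p (y : 'I_D -> int), p \in P /\
     f = \row_l (h * ((p l)%:R + n.+1%:R * (y l)%:~R))].

Lemma periodic_set_visibility (R : realType) (n d : nat) (h B : R)
    (P : {set {ffun 'I_d.+1 -> 'I_n.+1}}) (x v : 'rV[R]_d.+1) :
  0 < h -> 0 <= B ->
  (forall a W, steep W -> exists j, digital_line a W j \in P) ->
  sphere2 v ->
  exists (t : R) (f : 'rV[R]_d.+1),
    [/\ 0 <= t <= d.+1%:R * (2 * B + 2 * (h * n.+1%:R)), periodic_set h P f,
        norm2 (x + t *: v - f) <= d.+1%:R * (3 * h) & B - 3 * h <= norm2 f].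
Proof.
move=> h_gt0 B_ge0 hitP /sphere2_max_coord[i Dc_ge1 maxi].
set A := h * n.+1%:R.
have A_ge0 : 0 <= A by rewrite mulr_ge0 // ltW.
(* Dividing [v] by its largest coordinate gives slopes in [[-1, 1]]; one grid step then takes time
   [h / c], with [1 / c <= d + 1]. *)
pose c := `|v 0 i|.
have c_gt0 : 0 < c by rewrite lt_neqAle normr_ge0 andbT eq_sym;
  apply: contraTneq Dc_ge1; rewrite -/c => ->; rewrite mulr0 -ltNge ltr01.
have cV_le : c^-1 <= d.+1%:R by rewrite -[leLHS]mul1r ler_pdivrMr.
pose s l := v 0 l / c.
have s_le1 l : -1 <= s l <= 1.
  by rewrite -ler_norml normrM normfV (gtr0_norm c_gt0) ler_pdivrMr // mul1r.
have si1 : `|s i| = 1.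
  by rewrite normrM normfV (gtr0_norm c_gt0) divff // gt_eqF.
have vsi : v 0 i * s i = c.
  rewrite /s mulrA -expr2 -real_normK ?num_real // -/c.
  by field; rewrite gt_eqF.
(* Wait until the steepest coordinate exceeds [B], unless it is so far on the
   negative side that it stays below [- B] during the whole travel. *)
pose t0 : R := if - (B + A) <= x 0 i * s i then (2 * B + A) / c else 0.
have t0_ge0 : 0 <= t0.
  by rewrite /t0; case: ifP => // _; rewrite divr_ge0 ?(ltW c_gt0) //; lra.
have t0_le : t0 <= (2 * B + A) / c.
  by rewrite /t0; case: ifP => // _; rewrite divr_ge0 ?(ltW c_gt0) //; lra.
have [||a [W [sW yP]]] :=
    @digital_approx R n _ (fun l => (x 0 l + t0 * v 0 l) / h) s.
- exact: s_le1.
- by exists i.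
have [j jP] := hitP a W sW; have [y {}yP] := yP j.
pose z l : R := (digital_line a W j l)%:R + n.+1%:R * (y l)%:~R.
pose t := t0 + j%:R * h / c.
have jh_ge0 : 0 <= j%:R * h by rewrite mulr_ge0 // ltW.
have jh_le : j%:R * h <= A.
  by rewrite mulrC ler_pM2l // ler_nat ltnW.
have t_ge0 : 0 <= t by rewrite addr_ge0 // divr_ge0 // ltW.
have dist l : 0 <= x 0 l + t * v 0 l - h * z l <= 3 * h.
  have -> : x 0 l + t * v 0 l - h * z l =
      h * ((x 0 l + t0 * v 0 l) / h + j%:R * s l - z l).
    by rewrite /t /s; field; rewrite !gt_eqF.
  have /andP[z_ge z_le] := yP l.
  by rewrite mulr_ge0 ?(ltW h_gt0) //= mulrC ler_pM2r.
(* With the sign of [s i], the coordinate at time [t] is [x 0 i * s i + c * t0 + j * h]: at least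
   [- (B + A) + (2 * B + A) = B] after waiting, and below [- (B + A) + A = - B] otherwise. *)
have far : B <= `|x 0 i + t * v 0 i|.
  rewrite -[leRHS]mulr1 -si1 -normrM mulrDl -mulrA vsi /t mulrDl.
  rewrite mulfVK ?gt_eqF // ler_normr /t0; case: ifPn => [near|xlt]; apply/orP.
    by left; rewrite mulfVK ?gt_eqF //; lra.
  by move: xlt; rewrite -ltNge => xlt; right; lra.
exists t, (\row_l (h * z l)); split.
- rewrite t_ge0 (@le_trans _ _ (c^-1 * (2 * B + 2 * A))) //.
    rewrite /t; have -> : c^-1 * (2 * B + 2 * A) = (2 * B + A) / c + A / c.
      by field; rewrite gt_eqF.
    by rewrite lerD // ler_wpM2r // invr_ge0 ltW.
  by rewrite ler_wpM2r //; lra.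
- by exists (digital_line a W j), y.
- apply: norm2_le_coord => [|l]; first by rewrite mulr_ge0 // ltW.
  rewrite !mxE; have /andP[z_ge z_le] := dist l; by rewrite ger0_norm.
- apply: le_trans (le_coord_norm2 _ i); rewrite mxE.
  have /andP[z_ge z_le] := dist i.
  have := ler_normD (x 0 i + t * v 0 i - h * z i) (h * z i).
  rewrite subrK (ger0_norm z_ge); lra.
Qed.

Lemma periodic_set_count (R : realType) (n D : nat) (h T : R)
    (P : {set {ffun 'I_D -> 'I_n.+1}}) :
  0 < h -> h * n.+1%:R <= T ->
  exists2 s : seq 'rV[R]_D,
    (size s)%:R <= #|P|%:R * (5 * T / (h * n.+1%:R)) ^+ D &
    periodic_set h P `&` ball2 0 T `<=` [set` s].
Proof.
move=> h_gt0 leT; set A := h * n.+1%:R.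
have A_gt0 : 0 < A by rewrite mulr_gt0.
have TA_ge1 : 1 <= T / A by rewrite ler_pdivlMr // mul1r.
(* A point of the ball has period indices in [[- b, b]]. Since [T / A >= 1], these number
   [2 * b + 1 <= 2 * T / A + 3 <= 5 * T / A] per coordinate. *)
pose b := (Num.truncn (T / A)).+1.
have b_gt : T / A < b%:R by exact: truncnS_gt.
have b_le : b%:R <= T / A + 1.
  by rewrite -natr1 lerD2r truncn_le (le_trans ler01).
pose F (p : {ffun 'I_D -> 'I_n.+1}) (y : {ffun 'I_D -> 'I_(2 * b).+1}) :=
  \row_l (h * ((p l)%:R + n.+1%:R * ((y l)%:R - b%:R))) : 'rV[R]_D.
exists [seq F p y | p <- enum P, y <- enum {ffun 'I_D -> 'I_(2 * b).+1}].
  rewrite size_allpairs -!cardE card_ffun !card_ord natrM ler_wpM2l // natrX.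
  apply: lerXn2r; rewrite ?nnegrE //; first by rewrite -mulrA; lra.
  by rewrite -natr1 natrM -mulrA; lra.
move=> f [[p [y [pP ->]]]]; rewrite /ball2 /= subr0 => fT.
have yb l : (- b%:Z <= y l <= b%:Z)%R.
  have := le_trans (le_coord_norm2 _ l) fT.
  rewrite mxE ler_norml => /andP[fge fle].
  have hp_ge0 : 0 <= h * (p l)%:R by rewrite mulr_ge0 // ltW.
  have hp_lt : h * (p l)%:R < A by rewrite ltr_pM2l // ltr_nat.
  move: fge fle; rewrite mulrDr mulrA -/A => fge fle.
  have y_gt : - (T / A) - 1 < (y l)%:~R.
    have -> : - (T / A) - 1 = (- T - A) / A by field; rewrite gt_eqF.
    by rewrite ltr_pdivrMr //; lra.
  have y_le : (y l)%:~R <= T / A by rewrite ler_pdivlMr //; lra.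
  have y_lt : (y l)%:~R < (b%:Z)%:~R :> R by exact: le_lt_trans b_gt.
  have y_gt' : (- b%:Z - 1)%:~R < (y l)%:~R :> R.
    by rewrite rmorphB rmorphN /= -pmulrn; lra.
  by move: y_lt y_gt'; rewrite !ltr_int; move: (b) (y l); clear; lia.
apply/allpairsP => /=.
exists (p, [ffun l => inord (absz (y l + b%:Z))]); split=> /=.
- by rewrite mem_enum.
- by rewrite mem_enum.
apply/rowP => l; rewrite !mxE ffunE inordK; last first.
  by move: (yb l); move: (b) (y l); clear; lia.
congr (h * (_ + _ * _)).
have yE : y l = (absz (y l + b%:Z))%:Z - b%:Z.
  by move: (yb l); move: (b) (y l); clear; lia.
by rewrite {1}yE rmorphB /= -!pmulrn.
Qed.

(** * The forest at one dyadic scale *)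

Lemma dyadic_forest (R : realType) (d k : nat) : (1 <= d)%N ->
  exists G : set 'rV[R]_d.+1,
    [/\ forall f, G f -> 2 ^+ (2 * d * k) < norm2 f,
        forall T, 2 ^+ (2 * d * k) <= T ->
          exists2 s : seq 'rV[R]_d.+1,
            (size s)%:R <= (d.+1 * (4 * d + 4) + 1)%:R * 5 ^+ d.+1 * T ^+ d.+1
                           * (k.+1%:R / 2 ^+ k) &
            G `&` ball2 0 T `<=` [set` s]
      & forall x v : 'rV[R]_d.+1, sphere2 v ->
          exists (t : R) (f : 'rV[R]_d.+1),
            [/\ 0 <= t <= 12 * d.+1%:R * 2 ^+ (2 * d * k), G f
              & norm2 (x + t *: v - f) <= 3 * d.+1%:R / 2 ^+ k]].
Proof.
move=> d_ge1.
(* [N = 2 ^ e], and [J] exceeds the binary logarithm of the number of pairs of an origin and a slope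
   vector. *)
pose e := (k * (2 * d + 1))%N; pose J := (d.+1 * (2 * e + 2) + 1)%N.
pose n := (2 ^ e).-1; pose h : R := (2 ^+ k)^-1.
have NE : n.+1 = (2 ^ e)%N by rewrite prednK // expn_gt0.
have h_gt0 : 0 < h by rewrite invr_gt0 exprn_gt0.
have h_le1 : h <= 1 by rewrite invf_le1 ?exprn_gt0 // exprn_ege1 // ler1n.
have AE : h * n.+1%:R = 2 ^+ (2 * d * k).
  rewrite NE natrX /h.
  have -> : e = (k + 2 * d * k)%N by rewrite /e; lia.
  by rewrite exprD mulKf // expf_neq0 // pnatr_eq0.
have A_ge1 : 1 <= 2 ^+ (2 * d * k) :> R by rewrite exprn_ege1 // ler1n.
have [| P leP hitP] := @digital_hitting_set n d J.
  rewrite NE.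
  have le_base : (2 ^ e * (2 * 2 ^ e).+1 <= 2 ^ (2 * e + 2))%N.
    have : (0 < 2 ^ e)%N by rewrite expn_gt0.
    rewrite expnD mulnC expnM -(expnM 2 2 e) mulnC (mulnC 2 e) expnM; nia.
  apply: (@leq_ltn_trans ((2 ^ (2 * e + 2)) ^ d.+1)%N).
    by rewrite leq_exp2r.
  by rewrite -expnM ltn_exp2l // /J; lia.
exists (periodic_set h P `&` [set f | 2 ^+ (2 * d * k) < norm2 f]); split.
- by move=> f [].
- move=> T leT.
  have [|s les sub] := @periodic_set_count R n d.+1 h T P h_gt0.
    by rewrite AE.
  exists s; last by move=> f [[fP _] fT]; apply: sub.
  apply: (le_trans les); rewrite AE.
  have T_ge0 : 0 <= T by lra.
  have J_le : (J <= (d.+1 * (4 * d + 4) + 1) * k.+1)%N by rewrite /J /e; nia.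
  (* Comparing exponents, [N ^ d * 2 ^ k <= A ^ d.+1] reads [k * (2d^2 + d + 1) <= k * (2d^2 + 2d)],
     which holds as [d >= 1]. *)
  have P_le : #|P|%:R <= (2 ^+ (2 * d * k)) ^+ d.+1 / 2 ^+ k * J%:R :> R.
    apply: (@le_trans _ _ ((2 ^ e) ^ d * J)%:R); first by rewrite ler_nat -NE.
    rewrite natrM ler_wpM2r // ler_pdivlMr ?exprn_gt0 //.
    rewrite -exprM -expnM natrX -exprD ler_eXn2l ?ltr1n // /e; nia.
  set a := 2 ^+ (2 * d * k) in A_ge1 P_le *.
  apply: (@le_trans _ _ ((a ^+ d.+1 / 2 ^+ k * J%:R) * (5 * T / a) ^+ d.+1)).
    by rewrite ler_wpM2r // exprn_ge0 // divr_ge0 // ?mulr_ge0 //; lra.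
  have -> : (a ^+ d.+1 / 2 ^+ k * J%:R) * (5 * T / a) ^+ d.+1
      = 5 ^+ d.+1 * T ^+ d.+1 / 2 ^+ k * J%:R.
    rewrite !exprMn exprVn; field.
    by rewrite !expf_neq0 ?pnatr_eq0 //; lra.
  rewrite [leRHS](_ : _ = 5 ^+ d.+1 * T ^+ d.+1 / 2 ^+ k *
    ((d.+1 * (4 * d + 4) + 1) * k.+1)%:R); last by rewrite natrM; ring.
  rewrite ler_wpM2l ?ler_nat // !mulr_ge0 // ?invr_ge0 exprn_ge0 //.
(* With [B = 2 * A + 3] and [h <= 1], the point found has norm at least [2 * A > A], so it survives
   the deletion; the travel [2 * B + 2 * A = 6 * A + 6] is at most [12 * A]. *)
- move=> x v v1.
  have [|t [f [/andP[t_ge0 t_le] fP fx f_ge]]] :=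
    @periodic_set_visibility R n d h (2 * 2 ^+ (2 * d * k) + 3) P x v h_gt0 _
      hitP v1; first by lra.
  exists t, f; split.
  + rewrite t_ge0 (le_trans t_le) // AE.
    rewrite -(mulrA 12) (mulrCA 12) ler_wpM2l //; lra.
  + by split=> //=; lra.
  + by rewrite (le_trans fx) // mulrCA mulrA.
Qed.

(** * Finite density, and the union over all scales *)

Lemma sum_natr_geometric_le (R : realType) (K : nat) :
  \sum_(k < K) (k.+1%:R / 2 ^+ k) <= 4 :> R.
Proof.
suff -> : \sum_(k < K) (k.+1%:R / 2 ^+ k) = 4 - (K.+2)%:R * 2 / 2 ^+ K :> R.
  by rewrite gerBl divr_ge0 // ?exprn_ge0 // mulr_ge0.
elim: K => [|K IHK]; first by rewrite big_ord0 expr0; lra.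
rewrite big_ord_recr /= IHK exprS -[K.+3]addn3 -[K.+2]addn2 -[K.+1]addn1 !natrD.
by field; rewrite expf_neq0 // pnatr_eq0.
Qed.

Lemma counting_le_size (R : realType) (T : choiceType) (A : set T) (s : seq T) :
  A `<=` [set` s] -> (counting A <= (size s)%:R%:E :> \bar R)%E.
Proof.
move=> As; have finA : finite_set A by exact: sub_finite_set As (finite_seq s).
rewrite /counting asboolT // lee_fin ler_nat.
apply: (@leq_trans (size (undup s))); last exact: size_undup.
apply: uniq_leq_size; first exact: fset_uniq.
by move=> x; rewrite in_fset_set // mem_undup => /set_mem/As.
Qed.

Lemma finite_density_le (R : realType) (n : nat) (F : set 'rV[R]_n) (C : R) :
  (forall T : R, 1 <= T -> exists2 s : seq 'rV[R]_n,
    (size s)%:R <= C * T ^+ n & F `&` ball2 0 T `<=` [set` s]) ->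
  finite_density F.
Proof.
move=> countF; rewrite /finite_density limf_esupE.
apply: (@le_lt_trans _ _ C%:E); last exact: ltry.
apply: ge_ereal_inf => /=.
  eexists; first (exists [set T | 1 < T] => //).
    by exists 1; split => //; exact: num_real.
  apply: ge_ereal_sup => _ [T /= T_gt1 <-].
  have [s les sub] := countF T (ltW T_gt1).
  have Tn_gt0 : 0 < T ^+ n by rewrite exprn_gt0 //; lra.
  apply: (@le_trans _ _ ((size s)%:R%:E * ((T ^+ n)^-1)%:E)%E).
    apply: lee_wpmul2r; first by rewrite lee_fin invr_ge0 ltW.
    exact: counting_le_size.
  by rewrite -EFinM lee_fin ler_pdivrMr.
Qed.

Theorem theorem1p1 (R : realType) (d : nat) (hd : (1 <= d)%N) :
  exists (F : set 'rV[R]_d.+1) (eps0 : R) (V : R -> R),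
    [/\ finite_density F,
        0 < eps0,
        (forall eps : R, 0 < eps < eps0 -> 0 <= V eps),
        dense_forest F eps0 V
      & forall eta : R, 0 < eta ->
          exists C : R, 0 < C /\
            \forall eps \near 0^'+,
              V eps <= C * eps `^ (- (2 * d%:R) - eta)].
Proof.
have /choice[G GP] := fun k => @dyadic_forest R d k hd.
pose CF : R := (d.+1 * (4 * d + 4) + 1)%:R * 5 ^+ d.+1.
(* For the least [k] with [3 * d.+1 / eps <= 2 ^ k] one has [2 ^ k <= 6 * d.+1 / eps]; raised to the
   power [2 * d], this bounds the travel at scale [k]. *)
pose CV : R := 12 * d.+1%:R * (6 * d.+1%:R) ^+ (2 * d).
have CF_ge0 : 0 <= CF by rewrite mulr_ge0 // exprn_ge0.
have CV_gt0 : 0 < CV by rewrite !mulr_gt0 // exprn_gt0 // mulr_gt0.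
exists (\bigcup_k G k), 1, (fun eps => CV * eps^-1 ^+ (2 * d)); split.
- apply: (@finite_density_le _ _ _ (4 * CF)) => T T_ge1.
  have Tn_ge0 : 0 <= T ^+ d.+1 by rewrite exprn_ge0 //; lra.
  have levels K : exists2 s : seq 'rV[R]_d.+1,
      (size s)%:R <= CF * T ^+ d.+1 * \sum_(k < K) (k.+1%:R / 2 ^+ k) &
      forall k, (k < K)%N -> G k `&` ball2 0 T `<=` [set` s].
    elim: K => [|K [s les sub]].
      by exists [::] => //; rewrite big_ord0 mulr0.
    have [farG countG _] := GP K.
    have [s' les' sub'] : exists2 s' : seq 'rV[R]_d.+1,
        (size s')%:R <= CF * T ^+ d.+1 * (K.+1%:R / 2 ^+ K) &
        G K `&` ball2 0 T `<=` [set` s'].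
      (* If [T] is below the radius of the deleted ball, level [K] does not meet the ball of radius
         [T]. *)
      have [/countG // | ltT] := leP (2 ^+ (2 * d * K)) T.
      exists [::]; first by rewrite !mulr_ge0 // invr_ge0 exprn_ge0.
      move=> f [/farG ltf]; rewrite /ball2 /= subr0 => leT; lra.
    exists (s ++ s').
      by rewrite size_cat natrD big_ord_recr /= mulrDr lerD.
    move=> k; rewrite ltnS leq_eqVlt => /predU1P[->|ltk] f.
      by move/sub'; rewrite /= mem_cat => ->; rewrite orbT.
    by move/(sub k ltk); rewrite /= mem_cat => ->.
  (* Finitely many levels suffice: a point of [G k] in the ball gives
     [k <= 2 ^ (2 * d * k) <= T]. *)
  have [s les sub] := levels (Num.truncn T).+1.
  exists s.
    rewrite (le_trans les) // -[leRHS]mulrA [leRHS]mulrC.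
    by rewrite ler_wpM2l ?mulr_ge0 // sum_natr_geometric_le.
  move=> f [[k _ Gf] fT]; apply: (sub k) => //.
  have [/(_ f Gf) farf _ _] := GP k; move: fT; rewrite /ball2 /= subr0 => leT.
  rewrite -(ltr_nat R) (le_lt_trans _ (truncnS_gt T)) //.
  apply: le_trans leT; apply: le_trans (ltW farf).
  rewrite -natrX ler_nat ltnW // (leq_trans (ltn_expl k (ltnSn 1))) //.
  by rewrite leq_exp2l //; nia.
- exact: ltr01.
- move=> eps /andP[eps_gt0 _].
  by rewrite mulr_ge0 ?(ltW CV_gt0) // exprn_ge0 // invr_ge0 ltW.
- move=> eps x v /andP[eps_gt0 eps_lt1] v1.
  have exk : exists k : nat, 3 * d.+1%:R / eps <= 2 ^+ k.
    exists (Num.truncn (3 * d.+1%:R / eps)).+1.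
    rewrite ltW // (lt_le_trans (truncnS_gt _)) // -natrX ler_nat ltnW //.
    exact: ltn_expl.
  case: (ex_minnP exk) => k k_ge k_min.
  have [_ _ /(_ x v v1)[t [f [/andP[t_ge0 t_le] Gf fx]]]] := GP k.
  have k2 : 0 < 2 ^+ k :> R by rewrite exprn_gt0.
  exists t, f; split; last 1 first.
  + by rewrite (le_trans fx) // ler_pdivrMr // [leRHS]mulrC -ler_pdivrMr.
  + rewrite t_ge0 (le_trans t_le) // /CV -[leRHS]mulrA ler_wpM2l ?mulr_ge0 //.
    rewrite -exprMn mulnC exprM lerXn2r ?nnegrE ?(ltW k2) //.
      by rewrite divr_ge0 ?(ltW eps_gt0) // mulr_ge0.
    case: k k_ge k_min {t_le Gf fx k2} => [|k] k_ge k_min.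
      (* [k = 0] would force [3 * d.+1 <= eps < 1]. *)
      exfalso; move: k_ge; rewrite expr0 ler_pdivrMr // mul1r => k_ge.
      have : 1 <= d.+1%:R :> R by rewrite ler1n.
      lra.
    have : ~~ (3 * d.+1%:R / eps <= 2 ^+ k).
      by apply/negP => /k_min; rewrite ltnn.
    rewrite -ltNge exprS => lt_k.
    have -> : 6 * d.+1%:R / eps = 2 * (3 * d.+1%:R / eps).
      by field; rewrite gt_eqF.
    by rewrite ler_wpM2l // ltW.
  + by exists k.
(* One constant serves every [eta], since [eps ^ (- 2d) <= eps ^ (- 2d - eta)] for [eps < 1]. *)
- move=> eta eta_gt0; exists CV; split=> //.
  near=> eps.
  have eps_gt0 : 0 < eps by near: eps; exact: nbhs_right_gt.
  have eps_lt1 : eps < 1 by near: eps; exact: nbhs_right_lt.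
  rewrite ler_wpM2l ?(ltW CV_gt0) // exprVn.
  rewrite -powR_mulrn ?(ltW eps_gt0) // -powRN natrM.
  by apply: ger_powR; rewrite ?eps_gt0 ?(ltW eps_lt1) //; lra.
Unshelve. all: by end_near.
Qed.
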